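(* Let $f\in C^2([0,\infty))$. Let $g\in C^1(-1,1)\cap C[-1,1]$ satisfy $g(-x)=g(x)$ for $x\in(0,1)$, $g(0)>0$, and $xg'(x)\ge 0$ for $x\in(-1,1)$. For parameters $\lambda>0$, $\mu>0$ consider positive solutions of $$u''+\lambda f(u)-\mu g(x)=0,\quad -1<x<1,\qquad u(-1)=u(1)=0 .$$ Then the curves of positive solutions in the $(\lambda,u(0))$ plane, computed at different values of $\mu$, do not intersect. That is, if $\mu\neq\mu_1$ are positive, $\lambda>0$, $u$ is a positive solution for the parameters $(\lambda,\mu)$, and $v$ is a positive solution for the parameters $(\lambda,\mu_1)$, then $u(0)\ne v(0)$.
   Context: A positive solution is a function $u\in C^2(-1,1)\cap C^1[-1,1]$ satisfying the equation and the boundary conditions with $u(x)>0$ for all $x\in(-1,1)$. The curve of positive solutions at a given $\mu$ is the set of points $(\lambda,u(0))$ over all $\lambda>0$ and all positive solutions $u$ for the parameters $(\lambda,\mu)$. *)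

(* Defs.v *)
From Stdlib Require Export Reals.
From Coquelicot Require Export Coquelicot.
Open Scope R_scope.

(* Functions on a subset D of the line are represented by total functions
   R -> R.  The predicates below only look at values on D, since [D_in] and
   [continue_in] take difference quotients and limits within D; at an endpoint
   belonging to D they are the one-sided notions. *)

Fixpoint Ck_on (k : nat) (D : R -> Prop) (f : R -> R) : Prop :=
  match k with
  | O => forall x, D x -> continue_in f D x
  | S k' => exists f' : R -> R, (forall x, D x -> D_in f f' D x) /\ Ck_on k' D f'
  end.

Definition half_line (x : R) : Prop := 0 <= x.
Definition closed_interval (a b x : R) : Prop := a <= x <= b.

(* [Derive_n u 2] is a two-sided derivative; it is used only on the open
   interval, where the regularity of u makes it the genuine u''. *)
Definition positive_solution (f g : R -> R) (lambda mu : R) (u : R -> R) : Prop :=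
  Ck_on 2 (open_interval (-1) 1) u /\
  Ck_on 1 (closed_interval (-1) 1) u /\
  (forall x, -1 < x < 1 -> Derive_n u 2 x + lambda * f (u x) - mu * g x = 0) /\
  u (-1) = 0 /\
  u 1 = 0 /\
  (forall x, -1 < x < 1 -> 0 < u x).

Definition solution_curve (f g : R -> R) (mu : R) (p : R * R) : Prop :=
  exists (lambda : R) (u : R -> R),
    0 < lambda /\ positive_solution f g lambda mu u /\ p = (lambda, u 0).

(* Main.v *)
Require Import Defs.
From Stdlib Require Import Reals Lra Classical.
From Coquelicot Require Import Coquelicot.
Open Scope R_scope.

(** If [mu < mu1] and two positive solutions [u], [v] for the same [lambda]
    had the same value at 0, an energy comparison on an interval [0, xi] would
    give a contradiction.

    The comparison needs u'(0) = v'(0) = 0 and both solutions nonincreasing on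
    [0, 1].  This is the one-dimensional case of the symmetry theorem of Gidas,
    Ni and Nirenberg, available because - mu g(x) decreases with |x|; it is
    proved by moving planes ([moving_planes], [decreasing_from_centre]).  The
    reflected difference w(x) = u(s - x) - u(x) on [s/2, 1] satisfies
    w'' <= K |w|.  Both maximum principles used, the strong one and the one for
    narrow intervals, follow from a single exponential growth bound for
    nonnegative functions with w'' <= k^2 w ([growth_bound_right],
    [growth_bound_left]).

    Granting this, d = u - v satisfies d(0) = d'(0) = 0 and
    d''(0) = (mu - mu1) g(0) < 0, so d is negative just to the right of 0.  Let
    xi <= 1 be a point with d(xi) = 0 and d <= 0 on [0, xi].  Then
    v'(xi) <= u'(xi) <= 0.  On the other hand, multiplying the equations by u'
    and v', subtracting and integrating over [0, xi], the terms with f cancel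
    since u = v at both ends, and monotonicity of g, the sign of d and v' <= 0
    leave
      (u'(xi)^2 - v'(xi)^2) / 2 >= (mu1 - mu) g(0) (v(0) - v(xi)) > 0,
    which is impossible ([centre_values_incompatible]).

    The data are first replaced by functions defined and regular on the whole
    line that agree with them where it matters ([C1_extension],
    [solution_extension]), so that one-sided derivatives disappear; in
    particular xi = 1 is not a special case. *)

(** * From one-sided regularity to functions on the whole line *)

Lemma is_derive_continuity_pt (f : R -> R) (x l : R) :
  is_derive f x l -> continuity_pt f x.
Proof.
intros H; apply continuity_pt_filterlim.
apply (ex_derive_continuous f x); exists l; exact H.
Qed.

Lemma is_derive_of_D_in (f d : R -> R) (D : R -> Prop) (a b x : R) :
  (forall y, a < y < b -> D y) -> a < x < b -> D_in f d D x ->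
  is_derive f x (d x).
Proof.
intros HD Hx H.
apply is_derive_Reals, derivable_pt_lim_D_in.
intros eps Heps; destruct (H eps Heps) as [alp [Halp Hlim]].
exists (Rmin alp (Rmin (x - a) (b - x))); split.
- apply Rmin_pos; [exact Halp | apply Rmin_pos; lra].
- intros y [[_ Hyx] Hy].
  pose proof (Rmin_l alp (Rmin (x - a) (b - x))).
  pose proof (Rmin_r alp (Rmin (x - a) (b - x))).
  pose proof (Rmin_l (x - a) (b - x)).
  pose proof (Rmin_r (x - a) (b - x)).
  simpl in Hy; unfold R_dist in Hy.
  apply Hlim; split; [split; [apply HD | exact Hyx] | simpl; unfold R_dist; lra].
  assert (Hy' : Rabs (y - x) < Rmin (x - a) (b - x)) by lra.
  apply Rabs_def2 in Hy'; lra.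
Qed.

Definition clamp (a b x : R) : R := Rmax a (Rmin b x).

Lemma clamp_in (a b x : R) : a <= b -> closed_interval a b (clamp a b x).
Proof.
intros Hab; unfold closed_interval, clamp, Rmax, Rmin.
repeat destruct Rle_dec; lra.
Qed.

Lemma clamp_id (a b x : R) : closed_interval a b x -> clamp a b x = x.
Proof.
unfold closed_interval, clamp, Rmax, Rmin; intros H.
repeat destruct Rle_dec; lra.
Qed.

Lemma clamp_lipschitz (a b x y : R) :
  Rabs (clamp a b x - clamp a b y) <= Rabs (x - y).
Proof.
unfold clamp, Rmax, Rmin, Rabs.
repeat destruct Rle_dec; repeat destruct Rcase_abs; lra.
Qed.

Lemma continuity_clamp (g : R -> R) (a b : R) :
  a <= b -> (forall x, closed_interval a b x -> continue_in g (closed_interval a b) x) ->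
  forall x, continuity_pt (fun y => g (clamp a b y)) x.
Proof.
intros Hab Hg x eps Heps.
destruct (Hg _ (clamp_in a b x Hab) eps Heps) as [alp [Halp Hlim]].
exists alp; split; [exact Halp |].
intros y [_ Hy].
destruct (Req_dec (clamp a b y) (clamp a b x)) as [E | NE].
- simpl; unfold R_dist; rewrite E, Rminus_diag, Rabs_R0; exact Heps.
- apply Hlim; split; [split; [now apply clamp_in | now apply not_eq_sym] |].
  simpl in *; unfold R_dist in *.
  pose proof (clamp_lipschitz a b y x); lra.
Qed.

Lemma eq_near_interior (f h : R -> R) (a b x : R) :
  (forall y, a < y < b -> f y = h y) -> a < x < b ->
  locally x (fun y => f y = h y).
Proof.
intros H Hx.
assert (Hr : 0 < Rmin (x - a) (b - x)) by (apply Rmin_pos; lra).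
exists (mkposreal _ Hr); intros y Hy.
change (Rabs (y - x) < Rmin (x - a) (b - x)) in Hy.
pose proof (Rmin_l (x - a) (b - x)); pose proof (Rmin_r (x - a) (b - x)).
apply Rabs_def2 in Hy; apply H; lra.
Qed.

Lemma is_derive_RInt_cont (h : R -> R) (a x : R) :
  (forall y, continuity_pt h y) -> is_derive (RInt h a) x (h x).
Proof.
intros Hc.
assert (Hc' : forall y, continuous h y)
  by (intros y; apply continuity_pt_filterlim, Hc).
apply (is_derive_RInt h (RInt h a) a x); [| apply Hc'].
apply filter_forall; intros b.
apply (RInt_correct h), ex_RInt_continuous; intros; apply Hc'.
Qed.

(** The extension is the primitive of the derivative frozen outside the
    interval, so no difference quotient has to be computed at the endpoints. *)
Lemma C1_extension (a b : R) (u : R -> R) :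
  a <= b -> Ck_on 1 (closed_interval a b) u ->
  exists U U1 : R -> R,
    (forall x, a <= x <= b -> U x = u x) /\
    (forall x, is_derive U x (U1 x)) /\ (forall x, continuity_pt U1 x).
Proof.
intros Hab [u' [Hd Hc]].
set (U1 := fun y => u' (clamp a b y)).
assert (HU1 : forall x, continuity_pt U1 x) by (apply continuity_clamp; [exact Hab | exact Hc]).
set (U := fun x => u a + RInt U1 a x).
assert (HU : forall x, is_derive U x (U1 x)).
{ intros x; unfold U.
  replace (U1 x) with (0 + U1 x) by ring.
  apply (is_derive_plus (fun _ => u a)); [apply (is_derive_const (u a)) | now apply is_derive_RInt_cont]. }
exists U, U1; split; [| split; assumption].
assert (Huc : forall x, continuity_pt (fun y => u (clamp a b y)) x).
{ apply continuity_clamp; [exact Hab |].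
  intros x Hx; exact (cont_deriv _ _ _ _ (Hd x Hx)). }
intros x Hx.
destruct (MVT_gen (fun y => U y - u (clamp a b y)) a x (fun _ => 0)) as [c [_ H]].
- rewrite (Rmin_left a x), (Rmax_right a x) by lra.
  intros y Hy.
  replace 0 with (U1 y - u' y) by (unfold U1; rewrite clamp_id by (unfold closed_interval; lra); ring).
  apply (is_derive_minus U (fun y => u (clamp a b y))); [apply HU |].
  apply (is_derive_ext_loc u).
  + apply (eq_near_interior _ _ a b); [| lra].
    intros z Hz; rewrite clamp_id; [reflexivity | unfold closed_interval; lra].
  + apply (is_derive_of_D_in u u' (closed_interval a b) a b); [| lra |].
    * unfold closed_interval; intros; lra.
    * apply Hd; unfold closed_interval; lra.
- intros y _; apply continuity_pt_minus; [| apply Huc].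
  apply (is_derive_continuity_pt _ _ (U1 y)), HU.
- rewrite !clamp_id in H by (unfold closed_interval; lra).
  assert (U a = u a) by (unfold U; rewrite RInt_point; unfold zero; simpl; ring).
  lra.
Qed.

(** * Calculus on the line *)

(** The sign of the derivative is needed only inside the interval; replacing
    [df] by its negative part makes the location of the mean value point
    irrelevant. *)
Lemma nonincreasing_of_derive (f df : R -> R) (a b : R) :
  a <= b -> (forall x, continuity_pt f x) ->
  (forall x, a < x < b -> is_derive f x (df x)) ->
  (forall x, a < x < b -> df x <= 0) -> f b <= f a.
Proof.
intros Hab Hc Hd Hs.
destruct (MVT_gen f a b (fun x => Rmin 0 (df x))) as [c [_ Hc']].
- rewrite (Rmin_left a b), (Rmax_right a b) by exact Hab.
  intros x Hx; rewrite Rmin_right by (now apply Hs); now apply Hd.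
- intros; apply Hc.
- pose proof (Rmin_l 0 (df c)); cbv beta in Hc'; nra.
Qed.

Lemma derive_zero_at_min (f : R -> R) (a b c l : R) :
  a < c < b -> (forall x, a < x < b -> f c <= f x) -> is_derive f c l -> l = 0.
Proof.
intros Hc Hm Hd; apply is_derive_Reals in Hd.
set (pr := exist _ l Hd : derivable_pt f c).
change l with (derive_pt f c pr).
apply (deriv_minimum f a b c pr); [lra | lra |].
intros; apply Hm; lra.
Qed.

Lemma derive_nonneg_of_max_left (f : R -> R) (a c l : R) :
  a < c -> (forall x, a <= x <= c -> f x <= f c) -> is_derive f c l -> 0 <= l.
Proof.
intros Hac Hmax Hd; destruct (Rle_or_lt 0 l) as [|Hl]; [assumption | exfalso].
apply is_derive_Reals in Hd; destruct (Hd (- l)) as [e He]; [lra |].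
pose proof (cond_pos e) as Hepos.
set (q := Rmin (e / 2) (c - a)).
assert (Hq : 0 < q) by (apply Rmin_pos; lra).
assert (Hq1 : q <= e / 2) by apply Rmin_l.
assert (Hq2 : q <= c - a) by apply Rmin_r.
assert (Hlim : Rabs ((f (c + - q) - f c) / - q - l) < - l).
{ apply He; [lra |]; rewrite Rabs_Ropp, Rabs_pos_eq; lra. }
apply Rabs_def2 in Hlim.
assert (f (c + - q) <= f c) by (apply Hmax; lra).
assert (0 <= (f (c + - q) - f c) / - q).
{ replace ((f (c + - q) - f c) / - q) with ((f c - f (c + - q)) / q) by (field; lra).
  apply Rdiv_le_0_compat; lra. }
lra.
Qed.

Lemma lipschitz_of_C1 (f f1 : R -> R) (a b : R) :
  a <= b -> (forall x, is_derive f x (f1 x)) -> (forall x, continuity_pt f1 x) ->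
  exists K, 0 <= K /\ forall x y, a <= x <= b -> a <= y <= b ->
    Rabs (f x - f y) <= K * Rabs (x - y).
Proof.
intros Hab Hf Hc.
destruct (continuity_ab_maj (fun x => Rabs (f1 x)) a b Hab) as [z [Hz _]].
{ intros c _; apply (continuity_pt_comp f1 Rabs); [apply Hc | apply Rcontinuity_abs]. }
exists (Rabs (f1 z)); split; [apply Rabs_pos |]; intros x y Hx Hy.
destruct (MVT_gen f y x f1) as [c [Hcc E]].
- intros; apply Hf.
- intros t _; apply (is_derive_continuity_pt _ _ (f1 t)), Hf.
- rewrite E, Rabs_mult; apply Rmult_le_compat_r; [apply Rabs_pos |].
  apply Hz; unfold Rmin, Rmax in Hcc; destruct Rle_dec in Hcc; lra.
Qed.

Lemma is_derive_reflect (f : R -> R) (s x l : R) :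
  is_derive f (s - x) l -> is_derive (fun y => f (s - y)) x (- l).
Proof.
intros H; replace (- l) with (-1 * l) by ring.
apply (is_derive_comp f (fun y => s - y) x l (-1)); [exact H |].
auto_derive; [exact I | ring].
Qed.

Lemma continuity_pt_reflect (f : R -> R) (s x : R) :
  (forall y, continuity_pt f y) -> continuity_pt (fun y => f (s - y)) x.
Proof.
intros H; apply (continuity_pt_comp (fun y => s - y) f); [| apply H].
apply (is_derive_continuity_pt _ _ (-1)); auto_derive; [exact I | ring].
Qed.

(** * Growth of solutions of w'' <= k^2 w *)

(** Factoring the operator as (d/dx + k) (d/dx - k) turns the inequality into
    two monotonicity statements: first for exp (kx) (w' - k w), then for
    exp (-kx) w. *)
Lemma growth_bound_right (w w1 w2 : R -> R) (k c b : R) :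
  0 <= k -> c <= b ->
  (forall x, is_derive w x (w1 x)) -> (forall x, continuity_pt w1 x) ->
  (forall x, c < x < b -> is_derive w1 x (w2 x)) ->
  (forall x, c < x < b -> w2 x <= k * k * w x) ->
  w1 c = 0 -> 0 <= w c -> w b <= w c * exp (k * (b - c)).
Proof.
intros Hk Hcb Hw Hc1 Hw1 Hw2 Hc0 Hwc.
assert (Hcw : forall x, continuity_pt w x)
  by (intros x; apply (is_derive_continuity_pt _ _ (w1 x)), Hw).
assert (He : forall m x, is_derive (fun y => exp (m * y)) x (m * exp (m * x)))
  by (intros m x; auto_derive; [exact I | ring]).
assert (Hce : forall m x, continuity_pt (fun y => exp (m * y)) x)
  by (intros m x; apply (is_derive_continuity_pt _ _ (m * exp (m * x))), He).
assert (Hslope : forall x, c <= x <= b -> w1 x - k * w x <= 0).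
{ intros x Hx.
  assert (H : exp (k * x) * (w1 x - k * w x) <= exp (k * c) * (w1 c - k * w c)).
  { apply (nonincreasing_of_derive (fun y => exp (k * y) * (w1 y - k * w y))
             (fun y => exp (k * y) * (w2 y - k * k * w y))).
    - lra.
    - intros y; apply continuity_pt_mult; [apply Hce |].
      apply continuity_pt_minus; [apply Hc1 |].
      apply continuity_pt_mult; [now apply continuity_pt_const | apply Hcw].
    - intros y Hy.
      replace (exp (k * y) * (w2 y - k * k * w y)) with
        ((k * exp (k * y)) * (w1 y - k * w y) + exp (k * y) * (w2 y - k * w1 y)) by ring.
      apply (is_derive_mult (fun y => exp (k * y)) (fun y => w1 y - k * w y));
        [apply He | | exact Rmult_comm].
      apply (is_derive_minus w1 (fun y => k * w y)); [apply Hw1; lra |].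
      apply (is_derive_scal w), Hw.
    - intros y Hy; pose proof (exp_pos (k * y)).
      assert (w2 y <= k * k * w y) by (apply Hw2; lra); nra. }
  pose proof (exp_pos (k * x)); pose proof (exp_pos (k * c)).
  assert (0 <= k * w c) by nra.
  assert (exp (k * c) * (w1 c - k * w c) <= 0) by (rewrite Hc0; nra).
  nra. }
assert (H : exp (- k * b) * w b <= exp (- k * c) * w c).
{ apply (nonincreasing_of_derive (fun y => exp (- k * y) * w y)
           (fun y => exp (- k * y) * (w1 y - k * w y))).
  - lra.
  - intros y; apply continuity_pt_mult; [apply Hce | apply Hcw].
  - intros y Hy.
    replace (exp (- k * y) * (w1 y - k * w y)) with
      ((- k * exp (- k * y)) * w y + exp (- k * y) * w1 y) by ring.
    apply (is_derive_mult (fun y => exp (- k * y)) w); [apply He | apply Hw | exact Rmult_comm].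
  - intros y Hy; pose proof (exp_pos (- k * y)).
    assert (w1 y - k * w y <= 0) by (apply Hslope; lra); nra. }
replace (exp (- k * c)) with (exp (- k * b) * exp (k * (b - c))) in H
  by (rewrite <- exp_plus; f_equal; ring).
pose proof (exp_pos (- k * b)).
apply (Rmult_le_reg_l (exp (- k * b))); lra.
Qed.

Lemma growth_bound_left (w w1 w2 : R -> R) (k a c : R) :
  0 <= k -> a <= c ->
  (forall x, is_derive w x (w1 x)) -> (forall x, continuity_pt w1 x) ->
  (forall x, a < x < c -> is_derive w1 x (w2 x)) ->
  (forall x, a < x < c -> w2 x <= k * k * w x) ->
  w1 c = 0 -> 0 <= w c -> w a <= w c * exp (k * (c - a)).
Proof.
intros Hk Hac Hw Hc1 Hw1 Hw2 Hc0 Hwc.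
pose proof (growth_bound_right (fun y => w (0 - y)) (fun y => - w1 (0 - y))
              (fun y => w2 (0 - y)) k (- c) (- a)) as H; cbv beta in H.
replace (0 - - a) with a in H by ring.
replace (0 - - c) with c in H by ring.
replace (- a - - c) with (c - a) in H by ring.
apply H; clear H; try lra.
- intros x; apply is_derive_reflect, Hw.
- intros x; apply continuity_pt_opp, (continuity_pt_reflect w1 0 x Hc1).
- intros x Hx; rewrite <- (Ropp_involutive (w2 (0 - x))).
  apply (is_derive_opp (fun y => w1 (0 - y))), is_derive_reflect, Hw1; lra.
- intros x Hx; apply Hw2; lra.
Qed.

(** * Symmetry and monotonicity by moving planes *)

(** Real induction, going down from [b] to [a]. *)
Lemma downward_induction (P : R -> Prop) (a b : R) :
  a <= b -> P b -> (forall s t, s <= t -> P s -> P t) ->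
  (forall s, a <= s <= b -> (forall t, s < t -> P t) -> P s) ->
  (forall s, a < s <= b -> P s -> exists t, t < s /\ P t) -> P a.
Proof.
intros Hab Hb Hup Hclosed Hopen; apply NNPP; intros Ha.
assert (Hbound : forall t s, P t -> ~ P s -> s <= t).
{ intros t s Ht Hs; destruct (Rle_or_lt s t) as [|Hlt]; [assumption |].
  exfalso; apply Hs; apply (Hup t); [lra | exact Ht]. }
destruct (completeness (fun t => ~ P t)) as [m [Hm1 Hm2]].
- exists b; intros s Hs; now apply Hbound.
- now exists a.
- assert (Ham : a <= m) by (now apply Hm1).
  assert (Hmb : m <= b) by (apply Hm2; intros s Hs; now apply Hbound).
  assert (HPm : P m).
  { apply Hclosed; [lra |]; intros t Ht; apply NNPP; intros Hn.
    specialize (Hm1 t Hn); lra. }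
  assert (Hlt : a < m) by (destruct Ham as [|E]; [assumption | now subst]).
  destruct (Hopen m) as [t [Ht1 Ht2]]; [lra | exact HPm |].
  assert (m <= t) by (apply Hm2; intros s Hs; now apply Hbound); lra.
Qed.

(** The comparison is proved for all pairs with x + y >= s, lowering s from 2,
    where it is trivial, to 0.  To go below a given s: any negative minimum of
    the reflected difference w(z) = u(r - z) - u(z) lies at a definite distance
    from the axis r/2, while for r = s the difference has a positive lower
    bound there, and uniform continuity of [u] keeps it positive for r close to
    s.  Narrow intervals near s = 2 are the case where no such point fits in
    the interval. *)
Theorem moving_planes (u u1 p h : R -> R) (K : R) :
  (forall x, is_derive u x (u1 x)) -> (forall x, continuity_pt u1 x) ->
  (forall x, -1 < x < 1 -> is_derive u1 x (p x - h (u x))) ->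
  (forall x y, -1 < x < 1 -> -1 < y < 1 ->
     Rabs (h (u x) - h (u y)) <= K * Rabs (u x - u y)) ->
  (forall x y, -1 < x < 1 -> -1 < y < 1 -> Rabs y <= Rabs x -> p y <= p x) ->
  u 1 = 0 -> (forall x, -1 < x < 1 -> 0 < u x) ->
  forall x y, -1 <= y -> y <= x -> x <= 1 -> 0 <= x + y -> u x <= u y.
Proof.
intros Hu Hcu1 Hode HL Hp Hu1 Hpos.
assert (Hcu : forall x, continuity_pt u x)
  by (intros x; apply (is_derive_continuity_pt _ _ (u1 x)), Hu).
set (k := Rabs K + 1).
assert (Hk : 1 <= k) by (unfold k; pose proof (Rabs_pos K); lra).
assert (HKk : K <= k * k) by (unfold k in *; pose proof (Rle_abs K); nra).
pose (w := fun s x => u (s - x) - u x).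
pose (w1 := fun s x => - u1 (s - x) - u1 x).
pose (w2 := fun s x => (p (s - x) - h (u (s - x))) - (p x - h (u x))).
assert (Hw : forall s x, is_derive (w s) x (w1 s x)).
{ intros s x; apply (is_derive_minus (fun y => u (s - y)) u); [| apply Hu].
  apply is_derive_reflect, Hu. }
assert (Hcw : forall s x, continuity_pt (w s) x)
  by (intros s x; apply (is_derive_continuity_pt _ _ (w1 s x)), Hw).
assert (Hcw1 : forall s x, continuity_pt (w1 s) x).
{ intros s x; apply continuity_pt_minus; [| apply Hcu1].
  apply continuity_pt_opp, (continuity_pt_reflect u1 s x Hcu1). }
assert (Hw1 : forall s x, 0 < s -> s / 2 < x < 1 -> is_derive (w1 s) x (w2 s x)).
{ intros s x Hs Hx; apply (is_derive_minus (fun y => - u1 (s - y)) u1); [| apply Hode; lra].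
  unfold w2; rewrite <- (Ropp_involutive (p (s - x) - h (u (s - x)))).
  apply (is_derive_opp (fun y => u1 (s - y))), is_derive_reflect, Hode; lra. }
assert (Hw2 : forall s x, 0 < s -> s / 2 < x < 1 -> w2 s x <= k * k * Rabs (w s x)).
{ intros s x Hs Hx; unfold w2, w.
  assert (p (s - x) <= p x).
  { apply Hp; [lra | lra |]; rewrite (Rabs_pos_eq x) by lra.
    apply Rabs_le; lra. }
  assert (HL' : Rabs (h (u x) - h (u (s - x))) <= K * Rabs (u x - u (s - x)))
    by (apply HL; lra).
  rewrite (Rabs_minus_sym (u x)) in HL'.
  pose proof (Rle_abs (h (u x) - h (u (s - x)))).
  pose proof (Rabs_pos (u (s - x) - u x)); nra. }
set (H := fun s => forall x y, -1 <= y -> y <= x -> x <= 1 -> s <= x + y -> u x <= u y).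
apply (downward_induction H 0 2); unfold H; clear H.
- lra.
- intros x y _ Hyx Hx Hs; replace y with x by lra; lra.
- intros s t Hst Hs x y H1 H2 H3 H4; apply Hs; lra.
-
  (* A pair on the line x + y = s is approximated by pairs above it by raising
     the smaller coordinate, which stays in the interval even when x = 1. *)
  intros s Hs Ht x y H1 H2 H3 H4.
  destruct (Rle_or_lt (u x) (u y)) as [|Hlt]; [assumption | exfalso].
  assert (Hyx : y < x) by (destruct H2 as [|E]; [assumption | subst; lra]).
  destruct (Hcu y (u x - u y)) as [alp [Halp Hy]]; [lra |].
  set (e := Rmin (alp / 2) (x - y)).
  assert (He : 0 < e) by (apply Rmin_pos; lra).
  assert (He1 : e <= alp / 2) by apply Rmin_l.
  assert (He2 : e <= x - y) by apply Rmin_r.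
  specialize (Hy (y + e)); simpl in Hy; unfold R_dist in Hy.
  assert (Hd : Rabs (u (y + e) - u y) < u x - u y).
  { apply Hy; split; [split; [exact I | lra] |].
    replace (y + e - y) with e by ring; rewrite Rabs_pos_eq; lra. }
  apply Rabs_def2 in Hd.
  assert (u x <= u (y + e)) by (apply (Ht (s + e)); lra); lra.
- intros s Hs HPs.
  set (d := ln 2 / k / 2).
  assert (Hln2 : 0 < ln 2) by (rewrite <- ln_1; apply ln_increasing; lra).
  assert (Hd : 0 < d) by (unfold d; apply Rdiv_lt_0_compat; [apply Rdiv_lt_0_compat |]; lra).
  assert (Hkd : k * (2 * d) = ln 2) by (unfold d; field; lra).
  (* Away from the axis of reflection the reflected difference is strictly
     positive, by the strong maximum principle. *)
  assert (Hm : exists m, 0 < m /\ forall x, s / 2 + d <= x <= 1 -> m <= w s x).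
  { destruct (Rle_or_lt (s / 2 + d) 1) as [Hle | Hgt];
      [| exists 1; split; [lra | intros; lra]].
    destruct (continuity_ab_min (w s) (s / 2 + d) 1 Hle) as [c [Hmin Hc]];
      [intros; apply Hcw |].
    exists (w s c); split; [| exact Hmin].
    assert (Hnn : forall x, s / 2 <= x <= 1 -> 0 <= w s x).
    { intros x Hx; unfold w; assert (u x <= u (s - x)) by (apply HPs; lra); lra. }
    assert (Hend : 0 < w s 1).
    { unfold w; assert (0 < u (s - 1)) by (apply Hpos; lra); lra. }
    destruct (Hnn c) as [|E]; [lra | assumption | exfalso].
    assert (Hc1 : c < 1) by (destruct Hc as [_ [|E']]; [assumption | subst c; lra]).
    assert (Hb : w s 1 <= w s c * exp (k * (1 - c))).
    { apply (growth_bound_right (w s) (w1 s) (w2 s)); try lra.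
      - apply Hw.
      - apply Hcw1.
      - intros x Hx; apply Hw1; lra.
      - intros x Hx; rewrite <- (Rabs_pos_eq (w s x)) by (apply Hnn; lra).
        apply Hw2; lra.
      - apply (derive_zero_at_min (w s) (s / 2) 1 c); [lra | | apply Hw].
        intros x Hx; rewrite <- E; apply Hnn; lra. }
    rewrite <- E in Hb; lra. }
  destruct Hm as [m [Hm Hms]].
  destruct (@Heine_cor2 u (-1) 1 (fun x _ => Hcu x) (mkposreal m Hm)) as [eta Heta].
  simpl in Heta.
  set (t := s - Rmin (eta / 2) (Rmin (s / 2) (d / 2))).
  pose proof (cond_pos eta) as Heta0.
  assert (Ht : t < s).
  { unfold t; assert (0 < Rmin (eta / 2) (Rmin (s / 2) (d / 2)))
      by (apply Rmin_pos; [lra | apply Rmin_pos; lra]); lra. }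
  assert (Ht2 : s - t < eta /\ s - t < d /\ 0 < t).
  { unfold t; pose proof (Rmin_l (eta / 2) (Rmin (s / 2) (d / 2))).
    pose proof (Rmin_r (eta / 2) (Rmin (s / 2) (d / 2))).
    pose proof (Rmin_l (s / 2) (d / 2)); pose proof (Rmin_r (s / 2) (d / 2)); lra. }
  exists t; split; [exact Ht |].
  intros x y H1 H2 H3 H4.
  destruct (Rle_or_lt s (x + y)) as [Hge | Hlt]; [now apply HPs |].
  destruct (Rle_or_lt (u x) (u y)) as [|Hneg]; [assumption | exfalso].
  set (r := x + y) in *.
  assert (Hwx : w r x < 0) by (unfold w; replace (r - x) with y by (unfold r; ring); lra).
  destruct (continuity_ab_min (w r) (r / 2) 1) as [c [Hmin Hc]];
    [lra | intros; apply Hcw |].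
  assert (Hwc : w r c < 0) by (assert (w r c <= w r x) by (apply Hmin; unfold r; lra); lra).
  assert (Hw0 : w r (r / 2) = 0) by (unfold w; replace (r - r / 2) with (r / 2) by field; ring).
  assert (Hend : 0 < w r 1).
  { unfold w; assert (0 < u (r - 1)) by (apply Hpos; lra); lra. }
  assert (Hci : r / 2 < c < 1).
  { destruct Hc as [[Ha | Ha] [Hb | Hb]]; [lra | subst c; lra | subst c; lra | subst c; lra]. }
  (* With M = - w(c), the shifted function w + 2M dominates |w|, equals M at c
     and 2M on the axis, so it needs the distance ln 2 / k to double. *)
  assert (Hdouble : w r (r / 2) + 2 * - w r c <= (w r c + 2 * - w r c) * exp (k * (c - r / 2))).
  { apply (growth_bound_left (fun z => w r z + 2 * - w r c) (w1 r) (w2 r)); try lra.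
    - intros z; replace (w1 r z) with (w1 r z + 0) by ring.
      apply (is_derive_plus (w r) (fun _ => 2 * - w r c)); [apply Hw | apply (is_derive_const (2 * - w r c))].
    - apply Hcw1.
    - intros z Hz; apply Hw1; lra.
    - intros z Hz; apply (Rle_trans _ (k * k * Rabs (w r z))); [apply Hw2; lra |].
      apply Rmult_le_compat_l; [nra |].
      assert (w r c <= w r z) by (apply Hmin; lra).
      apply Rabs_le; lra.
    - apply (derive_zero_at_min (w r) (r / 2) 1 c); [lra | | apply Hw].
      intros z Hz; apply Hmin; lra. }
  rewrite Hw0 in Hdouble.
  assert (Hexp : 2 <= exp (k * (c - r / 2))) by nra.
  assert (Hdist : 2 * d <= c - r / 2).
  { destruct (Rle_or_lt (2 * d) (c - r / 2)) as [|Hn]; [assumption | exfalso].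
    assert (Hlt2 : k * (c - r / 2) < ln 2) by (rewrite <- Hkd; nra).
    apply exp_increasing in Hlt2; rewrite exp_ln in Hlt2 by lra; lra. }
  assert (Hws : m <= w s c) by (apply Hms; lra).
  assert (Hclose : Rabs (u (r - c) - u (s - c)) < m).
  { apply Heta; [lra | lra |].
    replace (r - c - (s - c)) with (r - s) by ring; apply Rabs_def1; lra. }
  apply Rabs_def2 in Hclose; unfold w in *; lra.
Qed.

(** Reflection turns the one-sided comparison of moving planes into its mirror
    image, so the centre is a maximum from both sides. *)
Corollary decreasing_from_centre (u u1 p h : R -> R) (K : R) :
  (forall x, is_derive u x (u1 x)) -> (forall x, continuity_pt u1 x) ->
  (forall x, -1 < x < 1 -> is_derive u1 x (p x - h (u x))) ->
  (forall x y, -1 < x < 1 -> -1 < y < 1 ->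
     Rabs (h (u x) - h (u y)) <= K * Rabs (u x - u y)) ->
  (forall x y, -1 < x < 1 -> -1 < y < 1 -> Rabs y <= Rabs x -> p y <= p x) ->
  u (-1) = 0 -> u 1 = 0 -> (forall x, -1 < x < 1 -> 0 < u x) ->
  u1 0 = 0 /\ forall x y, 0 <= x -> x <= y -> y <= 1 -> u y <= u x.
Proof.
intros Hu Hcu1 Hode HL Hp Hum1 Hup1 Hpos.
assert (HR := moving_planes u u1 p h K Hu Hcu1 Hode HL Hp Hup1 Hpos).
assert (HLft : forall x, 0 <= x <= 1 -> u (0 - x) <= u (0 - 0)).
{ intros x Hx.
  apply (moving_planes (fun y => u (0 - y)) (fun y => - u1 (0 - y))
           (fun y => p (0 - y)) h K); try lra.
  - intros y; apply is_derive_reflect, Hu.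
  - intros y; apply continuity_pt_opp, (continuity_pt_reflect u1 0 y Hcu1).
  - intros y Hy; rewrite <- (Ropp_involutive (p (0 - y) - h (u (0 - y)))).
    apply (is_derive_opp (fun z => u1 (0 - z))), is_derive_reflect, Hode; lra.
  - intros y z Hy Hz; apply HL; lra.
  - intros y z Hy Hz Hyz; apply Hp; [lra | lra |].
    now rewrite !Rminus_0_l, !Rabs_Ropp.
  - now rewrite Rminus_0_l.
  - intros y Hy; apply Hpos; lra. }
split; [| intros; apply HR; lra].
assert (H : - u1 0 = 0); [| lra].
apply (derive_zero_at_min (fun x => - u x) (-1) 1 0); [lra | |].
- intros x Hx; destruct (Rle_or_lt 0 x).
  + assert (u x <= u 0) by (apply HR; lra); lra.
  + specialize (HLft (- x)).
    replace (0 - - x) with x in HLft by ring; rewrite Rminus_0_r in HLft.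
    assert (u x <= u 0) by (apply HLft; lra); lra.
- apply (is_derive_opp u), Hu.
Qed.

(** * Two solutions with the same central value *)

(** The point is the supremum of those x for which d <= 0 on [0, x]. *)
Lemma end_of_nonpositive_interval (d : R -> R) (e : R) :
  0 < e < 1 -> (forall x, continuity_pt d x) ->
  (forall x, 0 <= x <= e -> d x <= 0) -> d 1 = 0 ->
  exists xi, e <= xi <= 1 /\ d xi = 0 /\ forall x, 0 <= x <= xi -> d x <= 0.
Proof.
intros He Hc Hneg H1.
destruct (completeness (fun x => x <= 1 /\ forall y, 0 <= y <= x -> d y <= 0)) as [xi [Hub Hlub]].
- exists 1; intros x Hx; lra.
- exists e; split; [lra | exact Hneg].
- assert (Hexi : e <= xi) by (apply Hub; split; [lra | exact Hneg]).
  assert (Hxi1 : xi <= 1) by (apply Hlub; intros x Hx; lra).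
  assert (Hbelow : forall y, 0 <= y < xi -> d y <= 0).
  { intros y Hy; destruct (Rle_or_lt (d y) 0) as [|Hn]; [assumption | exfalso].
    assert (xi <= y); [| lra].
    apply Hlub; intros x [Hx1 Hx].
    destruct (Rle_or_lt x y) as [|Hlt]; [assumption |].
    assert (d y <= 0) by (apply Hx; lra); lra. }
  assert (Hnhd : d xi <> 0 -> exists a, 0 < a /\
            forall y, Rabs (y - xi) < a -> Rabs (d y - d xi) < Rabs (d xi)).
  { intros Hne; destruct (Hc xi (Rabs (d xi))) as [a [Ha Hlim]]; [now apply Rabs_pos_lt |].
    exists a; split; [exact Ha |]; intros y Hy.
    destruct (Req_dec xi y) as [E | NE].
    - subst y; rewrite Rminus_diag, Rabs_R0; now apply Rabs_pos_lt.
    - apply Hlim; split; [split; [exact I | exact NE] | exact Hy]. }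
  assert (Hd : d xi = 0).
  { destruct (Rtotal_order (d xi) 0) as [Hlt | [E | Hgt]]; [exfalso | exact E | exfalso].
    - destruct Hnhd as [a [Ha Hn]]; [lra |].
      assert (Hlt1 : xi < 1) by (destruct Hxi1 as [|E]; [assumption | subst xi; lra]).
      set (q := Rmin (a / 2) (1 - xi)).
      assert (Hq : 0 < q) by (apply Rmin_pos; lra).
      assert (Hq1 : q <= a / 2) by apply Rmin_l.
      assert (Hq2 : q <= 1 - xi) by apply Rmin_r.
      assert (xi + q <= xi); [apply Hub; split; [lra |] | lra].
      intros y Hy; destruct (Rle_or_lt xi y) as [Hge | Hl]; [| apply Hbelow; lra].
      assert (Hy' : Rabs (d y - d xi) < Rabs (d xi)) by (apply Hn, Rabs_def1; lra).
      rewrite (Rabs_left (d xi)) in Hy' by exact Hlt.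
      apply Rabs_def2 in Hy'; lra.
    - destruct Hnhd as [a [Ha Hn]]; [lra |].
      set (q := Rmin (a / 2) (xi / 2)).
      assert (Hq : 0 < q) by (apply Rmin_pos; lra).
      assert (Hq1 : q <= a / 2) by apply Rmin_l.
      assert (Hq2 : q <= xi / 2) by apply Rmin_r.
      assert (Hy' : Rabs (d (xi - q) - d xi) < Rabs (d xi)) by (apply Hn, Rabs_def1; lra).
      rewrite (Rabs_pos_eq (d xi)) in Hy' by lra.
      apply Rabs_def2 in Hy'.
      assert (d (xi - q) <= 0) by (apply Hbelow; lra); lra. }
  exists xi; split; [lra |]; split; [exact Hd |].
  intros x Hx; destruct (Req_dec x xi) as [-> | NE]; [lra | apply Hbelow; lra].
Qed.

(** Comparison with the parabola - c x^2 / 2, where c = - d''(0) / 2. *)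
Lemma negative_of_second_derive (d d1 d2 : R -> R) :
  (forall x, is_derive d x (d1 x)) -> (forall x, continuity_pt d1 x) ->
  (forall x, 0 < x < 1 -> is_derive d1 x (d2 x)) -> continuity_pt d2 0 ->
  d 0 = 0 -> d1 0 = 0 -> d2 0 < 0 ->
  exists e, 0 < e < 1 /\ forall x, 0 < x <= e -> d x < 0.
Proof.
intros Hd Hc1 Hd1 Hc2 H0 H1 H2.
set (c := - d2 0 / 2).
destruct (Hc2 c) as [a [Ha Hlim]]; [unfold c; lra |].
set (e := Rmin (a / 2) (1 / 2)).
assert (He : 0 < e) by (apply Rmin_pos; lra).
assert (He1 : e <= a / 2) by apply Rmin_l.
assert (He2 : e <= 1 / 2) by apply Rmin_r.
assert (Hd2 : forall x, 0 < x <= e -> d2 x <= - c).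
{ intros x Hx; assert (H : Rabs (d2 x - d2 0) < c).
  { apply Hlim; split; [split; [exact I | lra] |].
    simpl; unfold R_dist; rewrite Rminus_0_r, Rabs_pos_eq; lra. }
  apply Rabs_def2 in H; unfold c in *; lra. }
assert (Hpoly : forall m x, is_derive (fun y => c * y ^ m) x (c * (INR m * x ^ pred m)))
  by (intros m x; apply is_derive_scal; auto_derive; [exact I | ring]).
assert (Hcpoly : forall m x, continuity_pt (fun y => c * y ^ m) x)
  by (intros m x; apply (is_derive_continuity_pt _ _ (c * (INR m * x ^ pred m))), Hpoly).
assert (Hb1 : forall x, 0 <= x <= e -> d1 x + c * x ^ 1 <= 0).
{ intros x Hx.
  assert (H : d1 x + c * x ^ 1 <= d1 0 + c * 0 ^ 1); [| lra].
  apply (nonincreasing_of_derive (fun y => d1 y + c * y ^ 1)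
           (fun y => d2 y + c * (INR 1 * y ^ 0))).
  - lra.
  - intros y; apply continuity_pt_plus; [apply Hc1 | apply Hcpoly].
  - intros y Hy; apply (is_derive_plus d1 (fun y => c * y ^ 1)); [apply Hd1; lra | apply (Hpoly 1%nat)].
  - intros y Hy; assert (d2 y <= - c) by (apply Hd2; lra); simpl; lra. }
exists e; split; [lra |]; intros x Hx.
assert (H : 2 * d x + c * x ^ 2 <= 2 * d 0 + c * 0 ^ 2).
{ apply (nonincreasing_of_derive (fun y => 2 * d y + c * y ^ 2)
           (fun y => 2 * d1 y + c * (INR 2 * y ^ 1))).
  - lra.
  - intros y; apply continuity_pt_plus; [| apply Hcpoly].
    apply continuity_pt_mult; [now apply continuity_pt_const |].
    apply (is_derive_continuity_pt _ _ (d1 y)), Hd.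
  - intros y Hy; apply (is_derive_plus (fun y => 2 * d y) (fun y => c * y ^ 2)); [| apply (Hpoly 2%nat)].
    apply (is_derive_scal d), Hd.
  - intros y Hy; assert (d1 y + c * y ^ 1 <= 0) by (apply Hb1; lra); simpl in *; lra. }
assert (Hc : 0 < c) by (unfold c; lra).
assert (0 < c * x ^ 2) by (apply Rmult_lt_0_compat; [exact Hc | apply pow_lt; lra]).
rewrite H0 in H; simpl in *; lra.
Qed.

(** With d = u - v, the function
      (u'^2 - v'^2)/2 + lambda (F(u) - F(v)) - mu g d - (mu - mu1) g(0) v,
    where F is a primitive of [f], has derivative
    (mu - mu1) (g - g(0)) v' - mu g' d, which is nonnegative as long as
    d <= 0.  Subtracting mu g d and (mu - mu1) g(0) v replaces the integration
    by parts of g u' and g v'. *)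
Lemma centre_values_incompatible (f g g1 u u1 v v1 : R -> R) (lambda mu mu1 : R) :
  (forall x, continuity_pt f x) -> (forall x, continuity_pt g x) ->
  (forall x, 0 < x < 1 -> is_derive g x (g1 x)) ->
  (forall x, 0 < x < 1 -> 0 <= g1 x) -> 0 < g 0 ->
  0 <= mu < mu1 ->
  (forall x, is_derive u x (u1 x)) -> (forall x, continuity_pt u1 x) ->
  (forall x, 0 < x < 1 -> is_derive u1 x (mu * g x - lambda * f (u x))) ->
  (forall x, is_derive v x (v1 x)) -> (forall x, continuity_pt v1 x) ->
  (forall x, 0 < x < 1 -> is_derive v1 x (mu1 * g x - lambda * f (v x))) ->
  u1 0 = 0 -> (forall x y, 0 <= x -> x <= y -> y <= 1 -> u y <= u x) ->
  v1 0 = 0 -> (forall x y, 0 <= x -> x <= y -> y <= 1 -> v y <= v x) ->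
  u 1 = v 1 -> u 0 <> v 0.
Proof.
intros Hcf Hcg Hg Hg1 Hg0 Hmu Hu Hcu1 Hode_u Hv Hcv1 Hode_v Hu0 Hmon_u Hv0 Hmon_v Huv1 Huv0.
assert (Hcu : forall x, continuity_pt u x)
  by (intros x; apply (is_derive_continuity_pt _ _ (u1 x)), Hu).
assert (Hcv : forall x, continuity_pt v x)
  by (intros x; apply (is_derive_continuity_pt _ _ (v1 x)), Hv).
assert (Hslope : forall w w1 : R -> R, (forall x, is_derive w x (w1 x)) ->
          (forall x y, 0 <= x -> x <= y -> y <= 1 -> w y <= w x) ->
          forall x, 0 < x <= 1 -> w1 x <= 0).
{ intros w w1 Hw Hmon x Hx.
  assert (0 <= - w1 x); [| lra].
  apply (derive_nonneg_of_max_left (fun y => - w y) 0 x); [lra | | apply (is_derive_opp w), Hw].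
  intros y Hy; assert (w x <= w y) by (apply Hmon; lra); lra. }
assert (Hgmon : forall x, 0 < x < 1 -> g 0 <= g x).
{ intros x Hx; assert (- g x <= - g 0); [| lra].
  apply (nonincreasing_of_derive (fun y => - g y) (fun y => - g1 y)).
  - lra.
  - intros y; apply continuity_pt_opp, Hcg.
  - intros y Hy; apply (is_derive_opp g), Hg; lra.
  - intros y Hy; assert (0 <= g1 y) by (apply Hg1; lra); lra. }
set (d := fun x => u x - v x).
assert (Hd : forall x, is_derive d x (u1 x - v1 x))
  by (intros x; apply (is_derive_minus u v); [apply Hu | apply Hv]).
destruct (negative_of_second_derive d (fun x => u1 x - v1 x)
  (fun x => (mu * g x - lambda * f (u x)) - (mu1 * g x - lambda * f (v x)))) as [e [He Hneg]].
- exact Hd.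
- intros x; apply continuity_pt_minus; [apply Hcu1 | apply Hcv1].
- intros x Hx; apply (is_derive_minus u1 v1); [now apply Hode_u | now apply Hode_v].
- assert (Hpart : forall m w, continuity_pt w 0 ->
            continuity_pt (fun x => m * g x - lambda * f (w x)) 0).
  { intros m w Hw; apply continuity_pt_minus.
    - apply continuity_pt_mult; [now apply continuity_pt_const | apply Hcg].
    - apply continuity_pt_mult; [now apply continuity_pt_const |].
      apply (continuity_pt_comp w f); [exact Hw | apply Hcf]. }
  apply continuity_pt_minus; apply Hpart; [apply Hcu | apply Hcv].
- unfold d; lra.
- lra.
- rewrite Huv0; nra.
- destruct (end_of_nonpositive_interval d e) as [xi [Hxi [Hdxi Hle]]].
  + exact He.
  + intros x; apply (is_derive_continuity_pt _ _ (u1 x - v1 x)), Hd.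
  + intros x Hx; destruct (Req_dec x 0) as [-> | NE]; [unfold d; lra |].
    assert (d x < 0) by (apply Hneg; lra); lra.
  + unfold d; lra.
  +
    (* v cannot be constant on [0, xi]: u would be the same constant, while
       u < v near the centre. *)
    assert (Hstrict : v xi < v 0).
    { assert (v xi <= v 0) by (apply Hmon_v; lra).
      assert (u e <= u 0) by (apply Hmon_u; lra).
      assert (u xi <= u e) by (apply Hmon_u; lra).
      assert (v e <= v 0) by (apply Hmon_v; lra).
      assert (v xi <= v e) by (apply Hmon_v; lra).
      assert (d e < 0) by (apply Hneg; lra).
      unfold d in *; lra. }
    assert (Hd1 : 0 <= u1 xi - v1 xi).
    { apply (derive_nonneg_of_max_left d 0 xi); [lra | | apply Hd].
      intros x Hx; rewrite Hdxi; apply Hle; lra. }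
    assert (Hu1 : u1 xi <= 0) by (apply (Hslope u u1 Hu Hmon_u); lra).
    set (F := RInt f 0).
    assert (HF : forall w w1 x, is_derive w x w1 -> is_derive (fun y => F (w y)) x (w1 * f (w x))).
    { intros w w1 x Hw; apply (is_derive_comp F w); [| exact Hw].
      now apply is_derive_RInt_cont. }
    assert (Hsq : forall w w1 x, is_derive w x w1 ->
              is_derive (fun y => w y * w y) x (w1 * w x + w x * w1)).
    { intros w w1 x Hw; apply (is_derive_mult w w); [exact Hw | exact Hw | exact Rmult_comm]. }
    assert (HcF : forall w, (forall x, continuity_pt w x) -> forall x, continuity_pt (fun y => F (w y)) x).
    { intros w Hw x; apply (continuity_pt_comp w F); [apply Hw |].
      apply (is_derive_continuity_pt _ _ (f (w x))); now apply is_derive_RInt_cont. }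
    (* The negative of the energy difference, hence nonincreasing. *)
    set (Psi := fun x => (/2) * (v1 x * v1 x - u1 x * u1 x) + lambda * (F (v x) - F (u x))
                         + mu * (g x * d x) + (mu - mu1) * g 0 * v x).
    assert (HPsi : Psi xi <= Psi 0).
    { apply (nonincreasing_of_derive Psi
        (fun x => (/2) * (((mu1 * g x - lambda * f (v x)) * v1 x + v1 x * (mu1 * g x - lambda * f (v x)))
                       - ((mu * g x - lambda * f (u x)) * u1 x + u1 x * (mu * g x - lambda * f (u x))))
          + lambda * (v1 x * f (v x) - u1 x * f (u x))
          + mu * (g1 x * d x + g x * (u1 x - v1 x)) + (mu - mu1) * g 0 * v1 x)).
      - lra.
      - assert (Hcc : forall a x, continuity_pt (fun _ : R => a) x)
          by (intros a x; now apply continuity_pt_const).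
        intros x; unfold Psi, d.
        apply continuity_pt_plus; [apply continuity_pt_plus; [apply continuity_pt_plus |] |].
        + apply continuity_pt_mult; [apply Hcc |].
          apply continuity_pt_minus; apply continuity_pt_mult; auto.
        + apply continuity_pt_mult; [apply Hcc |].
          apply continuity_pt_minus; apply HcF; assumption.
        + apply continuity_pt_mult; [apply Hcc |].
          apply continuity_pt_mult; [apply Hcg |].
          apply continuity_pt_minus; auto.
        + apply continuity_pt_mult; [apply Hcc | apply Hcv].
      - intros x Hx; unfold Psi.
        apply (is_derive_plus (fun x => (/2) * (v1 x * v1 x - u1 x * u1 x)
          + lambda * (F (v x) - F (u x)) + mu * (g x * d x)) (fun x => (mu - mu1) * g 0 * v x));
          [apply (is_derive_plus (fun x => (/2) * (v1 x * v1 x - u1 x * u1 x)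
             + lambda * (F (v x) - F (u x))) (fun x => mu * (g x * d x)));
           [apply (is_derive_plus (fun x => (/2) * (v1 x * v1 x - u1 x * u1 x))
              (fun x => lambda * (F (v x) - F (u x)))) |] |].
        + apply (is_derive_scal (fun x => v1 x * v1 x - u1 x * u1 x)).
          apply (is_derive_minus (fun x => v1 x * v1 x) (fun x => u1 x * u1 x)).
          * apply Hsq, Hode_v; lra.
          * apply Hsq, Hode_u; lra.
        + apply (is_derive_scal (fun x => F (v x) - F (u x))).
          apply (is_derive_minus (fun x => F (v x)) (fun x => F (u x))); apply HF; [apply Hv | apply Hu].
        + apply (is_derive_scal (fun x => g x * d x)).
          apply (is_derive_mult g d); [apply Hg; lra | apply Hd | exact Rmult_comm].
        + apply (is_derive_scal v), Hv.
      - intros x Hx.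
        assert (Hvx : v1 x <= 0) by (apply (Hslope v v1 Hv Hmon_v); lra).
        assert (Hgx : g 0 <= g x) by (apply Hgmon; lra).
        assert (Hg1x : 0 <= g1 x) by (apply Hg1; lra).
        assert (Hdx : d x <= 0) by (apply Hle; lra).
        assert (g1 x * d x <= 0) by nra.
        assert (mu * (g1 x * d x) <= 0) by nra.
        assert (0 <= (mu1 - mu) * (g x - g 0)) by nra.
        assert ((mu1 - mu) * (g x - g 0) * v1 x <= 0) by nra.
        match goal with |- ?L <= 0 =>
          replace L with (mu * (g1 x * d x) + (mu1 - mu) * (g x - g 0) * v1 x) by field
        end; lra. }
    assert (Exi : u xi = v xi) by (unfold d in Hdxi; lra).
    unfold Psi, d in HPsi; rewrite Exi, Huv0, Hu0, Hv0 in HPsi.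
    assert (0 < (mu1 - mu) * g 0 * (v 0 - v xi))
      by (apply Rmult_lt_0_compat; [apply Rmult_lt_0_compat |]; lra).
    nra.
Qed.

(** * The boundary value problem *)

(** At the endpoints only the first derivative is extended: the differential
    equation is kept on the open interval. *)
Lemma solution_extension (f g u : R -> R) (lambda mu : R) :
  positive_solution f g lambda mu u ->
  exists U U1 : R -> R,
    (forall x, -1 <= x <= 1 -> U x = u x) /\
    (forall x, is_derive U x (U1 x)) /\ (forall x, continuity_pt U1 x) /\
    (forall x, -1 < x < 1 -> is_derive U1 x (mu * g x - lambda * f (U x))).
Proof.
intros [[u' [Hu' [u'' [Hu'' _]]]] [HC1 [Hode _]]].
destruct (C1_extension (-1) 1 u) as [U [U1 [HU [HdU HcU1]]]]; [lra | exact HC1 |].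
exists U, U1; split; [exact HU |]; split; [exact HdU |]; split; [exact HcU1 |].
assert (Hder : forall x, -1 < x < 1 -> Derive u x = u' x).
{ intros x Hx; apply is_derive_unique.
  apply (is_derive_of_D_in u u' (open_interval (-1) 1) (-1) 1); [intros y Hy; exact Hy | exact Hx |].
  apply Hu'; exact Hx. }
assert (HU1 : forall x, -1 < x < 1 -> u' x = U1 x).
{ intros x Hx; rewrite <- Hder by exact Hx; apply is_derive_unique.
  apply (is_derive_ext_loc U); [| apply HdU].
  apply (eq_near_interior _ _ (-1) 1); [intros y Hy; apply HU; lra | exact Hx]. }
intros x Hx.
assert (H2 : is_derive u' x (u'' x)).
{ apply (is_derive_of_D_in u' u'' (open_interval (-1) 1) (-1) 1); [intros y Hy; exact Hy | exact Hx |].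
  apply Hu''; exact Hx. }
assert (E : Derive_n u 2 x = u'' x).
{ change (Derive (fun y => Derive u y) x = u'' x).
  rewrite (Derive_ext_loc (fun y => Derive u y) u').
  - apply is_derive_unique, H2.
  - apply (eq_near_interior _ _ (-1) 1); [exact Hder | exact Hx]. }
specialize (Hode x Hx); rewrite E in Hode.
rewrite HU by lra.
replace (mu * g x - lambda * f (u x)) with (u'' x) by lra.
apply (is_derive_ext_loc u'); [| exact H2].
apply (eq_near_interior _ _ (-1) 1); [exact HU1 | exact Hx].
Qed.

Lemma Ck_on_1_restrict (f : R -> R) (D E : R -> Prop) :
  (forall x, E x -> D x) -> Ck_on 1 D f -> Ck_on 1 E f.
Proof.
intros HED [f' [Hd Hc]]; exists f'; split.
- intros x Hx eps Heps; destruct (Hd x (HED x Hx) eps Heps) as [a [Ha Hlim]].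
  exists a; split; [exact Ha |]; intros y [[Hy Hne] Hdist].
  apply Hlim; split; [split; [now apply HED | exact Hne] | exact Hdist].
- intros x Hx eps Heps; destruct (Hc x (HED x Hx) eps Heps) as [a [Ha Hlim]].
  exists a; split; [exact Ha |]; intros y [[Hy Hne] Hdist].
  apply Hlim; split; [split; [now apply HED | exact Hne] | exact Hdist].
Qed.

(** The nonlinearity is used only on the common range [0, M] of the two
    solutions, so it may be replaced by an extension from that interval, which
    is Lipschitz there. *)
Lemma centre_values_differ (f g : R -> R) (lambda mu mu1 : R) (u v : R -> R) :
  Ck_on 1 half_line f ->
  Ck_on 1 (open_interval (-1) 1) g ->
  Ck_on 0 (closed_interval (-1) 1) g ->
  (forall x, 0 < x < 1 -> g (- x) = g x) ->
  0 < g 0 ->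
  (forall x, -1 < x < 1 -> 0 <= x * Derive g x) ->
  0 < mu < mu1 ->
  positive_solution f g lambda mu u -> positive_solution f g lambda mu1 v ->
  u 0 <> v 0.
Proof.
intros Hf [g' [Hg' _]] Hcg Hgeven Hg0 Hgmon Hmu Hsu Hsv.
pose (G := fun x => g (clamp (-1) 1 x)).
assert (HG : forall x, -1 <= x <= 1 -> G x = g x)
  by (intros x Hx; unfold G; rewrite clamp_id; [reflexivity | exact Hx]).
assert (HcG : forall x, continuity_pt G x)
  by (apply continuity_clamp; [lra | exact Hcg]).
assert (HdG : forall x, -1 < x < 1 -> is_derive G x (Derive g x)).
{ intros x Hx.
  assert (Hd : is_derive g x (g' x)).
  { apply (is_derive_of_D_in g g' (open_interval (-1) 1) (-1) 1);
      [intros y Hy; exact Hy | exact Hx | apply Hg'; exact Hx]. }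
  rewrite (is_derive_unique _ _ _ Hd).
  apply (is_derive_ext_loc g); [| exact Hd].
  apply (eq_near_interior _ _ (-1) 1); [intros y Hy; symmetry; apply HG; lra | exact Hx]. }
assert (Hg1 : forall x, 0 < x < 1 -> 0 <= Derive g x).
{ intros x Hx; assert (0 <= x * Derive g x) by (apply Hgmon; lra); nra. }
assert (HGabs : forall x, -1 < x < 1 -> G x = G (Rabs x)).
{ intros x Hx; unfold Rabs; destruct Rcase_abs; [| reflexivity].
  rewrite !HG by lra; rewrite <- (Hgeven (- x)) by lra; now rewrite Ropp_involutive. }
assert (HGmon : forall x y, -1 < x < 1 -> -1 < y < 1 -> Rabs y <= Rabs x -> G y <= G x).
{ intros x y Hx Hy Hxy; rewrite (HGabs x Hx), (HGabs y Hy).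
  pose proof (Rabs_pos y); assert (Rabs x < 1) by (apply Rabs_def1; lra).
  assert (- G (Rabs x) <= - G (Rabs y)); [| lra].
  apply (nonincreasing_of_derive (fun z => - G z) (fun z => - Derive g z)).
  - exact Hxy.
  - intros z; apply continuity_pt_opp, HcG.
  - intros z Hz; apply (is_derive_opp G), HdG; lra.
  - intros z Hz; assert (0 <= Derive g z) by (apply Hg1; lra); lra. }
destruct (solution_extension _ _ _ _ _ Hsu) as [U [U1 [HU [HdU [HcU1 HodeU]]]]].
destruct (solution_extension _ _ _ _ _ Hsv) as [V [V1 [HV [HdV [HcV1 HodeV]]]]].
destruct Hsu as [_ [_ [_ [Hum [Hup Hupos]]]]].
destruct Hsv as [_ [_ [_ [Hvm [Hvp Hvpos]]]]].
assert (Hbound : forall W W1 : R -> R, (forall x, is_derive W x (W1 x)) ->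
          exists M, forall x, -1 <= x <= 1 -> W x <= M).
{ intros W W1 HW; destruct (continuity_ab_maj W (-1) 1) as [z [Hz _]]; [lra | |].
  - intros c _; apply (is_derive_continuity_pt _ _ (W1 c)), HW.
  - exists (W z); exact Hz. }
destruct (Hbound U U1 HdU) as [MU HMU]; destruct (Hbound V V1 HdV) as [MV HMV].
set (M := Rmax MU MV).
assert (HM1 : MU <= M) by apply Rmax_l.
assert (HM2 : MV <= M) by apply Rmax_r.
assert (HrU : forall x, -1 < x < 1 -> 0 <= U x <= M).
{ intros x Hx; split; [rewrite HU by lra; left; apply Hupos; lra |].
  assert (U x <= MU) by (apply HMU; lra); lra. }
assert (HrV : forall x, -1 < x < 1 -> 0 <= V x <= M).
{ intros x Hx; split; [rewrite HV by lra; left; apply Hvpos; lra |].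
  assert (V x <= MV) by (apply HMV; lra); lra. }
assert (HM : 0 <= M) by (assert (0 <= U 0 <= M) by (apply HrU; lra); lra).
destruct (C1_extension 0 M f HM) as [h [h1 [Hh [Hdh Hch1]]]].
{ apply (Ck_on_1_restrict f half_line); [| exact Hf].
  unfold closed_interval, half_line; intros; lra. }
destruct (lipschitz_of_C1 h h1 0 M HM Hdh Hch1) as [K [HK HLip]].
(* The two problems differ only in mu, so the properties of a single solution
   are derived once. *)
assert (Hshape : forall m W W1, 0 < m ->
          (forall x, is_derive W x (W1 x)) -> (forall x, continuity_pt W1 x) ->
          (forall x, -1 < x < 1 -> is_derive W1 x (m * g x - lambda * f (W x))) ->
          (forall x, -1 < x < 1 -> 0 <= W x <= M) ->
          (forall x, -1 < x < 1 -> 0 < W x) -> W (-1) = 0 -> W 1 = 0 ->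
          (forall x, -1 < x < 1 -> is_derive W1 x (m * G x - lambda * h (W x))) /\
          W1 0 = 0 /\ forall x y, 0 <= x -> x <= y -> y <= 1 -> W y <= W x).
{ intros m W W1 Hm HdW HcW1 HodeW HrW HposW HWm HWp.
  assert (Hode : forall x, -1 < x < 1 -> is_derive W1 x (m * G x - lambda * h (W x))).
  { intros x Hx; rewrite HG by lra; rewrite Hh by (now apply HrW); now apply HodeW. }
  split; [exact Hode |].
  apply (decreasing_from_centre W W1 (fun x => m * G x) (fun t => lambda * h t)
           (Rabs lambda * K)); try assumption.
  - intros x y Hx Hy; rewrite <- Rmult_minus_distr_l, Rabs_mult, Rmult_assoc.
    apply Rmult_le_compat_l; [apply Rabs_pos |].
    apply HLip; now apply HrW.
  - intros x y Hx Hy Hxy; apply Rmult_le_compat_l; [lra | now apply HGmon]. }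
destruct (Hshape mu U U1) as [HoU [HU0 HmonU]]; try assumption; try lra.
{ intros x Hx; rewrite HU by lra; now apply Hupos. }
{ now rewrite HU by lra. }
{ now rewrite HU by lra. }
destruct (Hshape mu1 V V1) as [HoV [HV0 HmonV]]; try assumption; try lra.
{ intros x Hx; rewrite HV by lra; now apply Hvpos. }
{ now rewrite HV by lra. }
{ now rewrite HV by lra. }
rewrite <- (HU 0), <- (HV 0) by lra.
apply (centre_values_incompatible h G (Derive g) U U1 V V1 lambda mu mu1); try assumption.
- intros x; apply (is_derive_continuity_pt _ _ (h1 x)), Hdh.
- intros x Hx; apply HdG; lra.
- now rewrite HG by lra.
- lra.
- intros x Hx; apply HoU; lra.
- intros x Hx; apply HoV; lra.
- rewrite HU, HV by lra; now rewrite Hup, Hvp.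
Qed.

Theorem lemma2p3 :
  forall f g : R -> R,
    Ck_on 2 half_line f ->
    Ck_on 1 (open_interval (-1) 1) g ->
    Ck_on 0 (closed_interval (-1) 1) g ->
    (forall x, 0 < x < 1 -> g (- x) = g x) ->
    0 < g 0 ->
    (forall x, -1 < x < 1 -> 0 <= x * Derive g x) ->
    forall mu mu1 : R, 0 < mu -> 0 < mu1 -> mu <> mu1 ->
      (forall p : R * R, ~ (solution_curve f g mu p /\ solution_curve f g mu1 p)) /\
      (forall (lambda : R) (u v : R -> R),
         0 < lambda ->
         positive_solution f g lambda mu u ->
         positive_solution f g lambda mu1 v ->
         u 0 <> v 0).
Proof.
intros f g [f' [Hf [f'' [Hf' _]]]] Hg Hcg Heven Hg0 Hmon mu mu1 Hmu Hmu1 Hne.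
assert (Hf1 : Ck_on 1 half_line f).
{ exists f'; split; [exact Hf |].
  intros x Hx; exact (cont_deriv _ _ _ _ (Hf' x Hx)). }
assert (Hvals : forall (lambda : R) (u v : R -> R),
          positive_solution f g lambda mu u ->
          positive_solution f g lambda mu1 v -> u 0 <> v 0).
{ intros lambda u v Hu Hv.
  destruct (Rtotal_order mu mu1) as [Hlt | [E | Hgt]]; [| contradiction |].
  - apply (centre_values_differ f g lambda mu mu1); try assumption; lra.
  - apply not_eq_sym, (centre_values_differ f g lambda mu1 mu); try assumption; lra. }
split.
- intros p [[lambda [u [_ [Hu E]]]] [lambda' [v [_ [Hv E']]]]].
  rewrite E in E'; injection E' as <- E0.
  exact (Hvals lambda u v Hu Hv E0).
- intros lambda u v _; apply Hvals.
Qed.
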